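(* There does not exist a constant $C_1>0$ such that for all sequences $(\gamma_0^{(n)})_{n\in\mathbb{N}}\in\mathcal{H}^1$, all $k\in\mathbb{N}$ and all $j\in\{1,\dots,k\}$ one has $$\|S^{(k,1)}B_{j,k+1}\,\mathcal{U}^{(k+1)}(t)\gamma_0^{(k+1)}\|_{L^2([0,2\pi]\times\Lambda^k\times\Lambda^k)}\le C_1\|S^{(k+1,1)}\gamma_0^{(k+1)}\|_{L^2(\Lambda^{k+1}\times\Lambda^{k+1})}.$$
   Context: $\Lambda=\mathbb{T}^3=(\mathbb{R}/2\pi\mathbb{Z})^3$; $\vec{x}_k=(x_1,\dots,x_k)$, $\vec{x}_k'=(x_1',\dots,x_k')$ with $x_j,x_j'\in\Lambda$. All $k$-particle density matrices $\gamma_0^{(k)}:\Lambda^k\times\Lambda^k\to\mathbb{C}$ satisfy $\gamma_0^{(k)}(\vec{x}_k;\vec{x}_k')=\overline{\gamma_0^{(k)}(\vec{x}_k';\vec{x}_k)}$ and $\gamma_0^{(k)}(x_{\sigma(1)},\dots,x_{\sigma(k)};x'_{\sigma(1)},\dots,x'_{\sigma(k)})=\gamma_0^{(k)}(\vec{x}_k;\vec{x}_k')$ for all $\sigma\in S_k$. Fourier transform: $(\gamma_0^{(k)})^{\wedge}(\vec{n}_k;\vec{n}_k')=\int_{\Lambda^k\times\Lambda^k}\gamma_0^{(k)}(\vec{x}_k;\vec{x}_k')e^{-i\sum_j\langle x_j,n_j\rangle+i\sum_j\langle x_j',n_j'\rangle}d\vec{x}_kd\vec{x}_k'$, with $\vec{n}_k,\vec{n}_k'\in(\mathbb{Z}^3)^k$.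 $S^{(k,1)}=\prod_{j=1}^k(1-\Delta_{x_j})^{1/2}(1-\Delta_{x_j'})^{1/2}$. A sequence $(\gamma_0^{(k)})_k$ of $k$-particle density matrices belongs to $\mathcal{H}^1$ if $\|S^{(k,1)}\gamma_0^{(k)}\|_{L^2(\Lambda^k\times\Lambda^k)}<\infty$ for all $k$. Free evolution: $\mathcal{U}^{(k)}(t)\gamma_0^{(k)}=e^{it\sum_{j=1}^k\Delta_{x_j}}\gamma_0^{(k)}e^{-it\sum_{j=1}^k\Delta_{x_j'}}$, i.e. multiplication of $(\gamma_0^{(k)})^\wedge(\vec{n}_k;\vec{n}_k')$ by $e^{-it(|\vec{n}_k|^2-|\vec{n}_k'|^2)}$. Collision operator: for $1\le j\le k$, $B_{j,k+1}=B^+_{j,k+1}-B^-_{j,k+1}$, where $$B^{+}_{j,k+1}(\gamma_0^{(k+1)})(\vec{x}_k;\vec{x}_k')=\int_\Lambda \delta(x_j-x_{k+1})\,\gamma_0^{(k+1)}(\vec{x}_k,x_{k+1};\vec{x}_k',x_{k+1})\,dx_{k+1},$$ $$B^{-}_{j,k+1}(\gamma_0^{(k+1)})(\vec{x}_k;\vec{x}_k')=\int_\Lambda \delta(x_j'-x_{k+1})\,\gamma_0^{(k+1)}(\vec{x}_k,x_{k+1};\vec{x}_k',x_{k+1})\,dx_{k+1}.$$ These are understood through Fourier series; e.g., up to an absolute normalizing constant, $(B^+_{1,k+1}\gamma_0^{(k+1)})^\wedge(\vec{n}_k;\vec{n}_k')=\sum_{n_{k+1},n_{k+1}'\in\mathbb{Z}^3}(\gamma_0^{(k+1)})^\wedge(n_1-n_{k+1}+n_{k+1}',n_2,\dots,n_{k+1};n_1',\dots,n_{k+1}')$.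 *)

(* Defs.v *)
From HB Require Import structures.
From mathcomp Require Import all_boot all_order all_algebra perm.
From mathcomp Require Import complex.
From mathcomp Require Import all_classical all_reals all_analysis.

Set Implicit Arguments.
Unset Strict Implicit.
Unset Printing Implicit Defensive.
Import Order.TTheory GRing.Theory Num.Theory.
Import numFieldNormedType.Exports.

Local Open Scope classical_set_scope.
Local Open Scope ring_scope.
Local Open Scope complex_scope.

(** * Products of finite measures *)

(* The library's sigma-finite instance on [m1 \x m2] is shadowed by the one for
   subprobabilities, hence this alias. *)
Section ProdMeasure.
Context d1 d2 (T1 : measurableType d1) (T2 : measurableType d2) (R : realType).
Variables (mu : {finite_measure set T1 -> \bar R}).
Variables (nu : {finite_measure set T2 -> \bar R}).

Definition prod_measure : set (T1 * T2) -> \bar R := (mu \x nu)%E.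

HB.instance Definition _ := Measure.on prod_measure.

Let prod_measure_fin : fin_num_fun prod_measure.
Proof.
apply: lty_fin_num_fun => /=.
have -> : prod_measure setT = (mu setT * nu setT)%E.
  by rewrite -product_measure1E// setXTT.
by rewrite lte_mul_pinfty ?fin_num_measure// ltey_eq fin_num_measure.
Qed.

HB.instance Definition _ :=
  Measure_isFinite.Build _ _ _ prod_measure prod_measure_fin.

End ProdMeasure.

Section TupleMeasure.
Context d (T : measurableType d) (R : realType).
Variable mu : {finite_measure set T -> \bar R}.

Section Cons.
Context (n : nat) (nu : {finite_measure set (n.-tuple T) -> \bar R}).

Definition cons_pair (x : T * n.-tuple T) : n.+1.-tuple T :=
  [tuple of x.1 :: x.2].

Lemma measurable_cons_pair : measurable_fun setT cons_pair.
Proof. exact: measurable_cons. Qed.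

Definition cons_measure : set (n.+1.-tuple T) -> \bar R :=
  pushforward (prod_measure mu nu) cons_pair.

Let cons_measure0 : cons_measure set0 = 0%E.
Proof. by rewrite /cons_measure /pushforward preimage_set0 measure0. Qed.

Let cons_measure_ge0 A : (0 <= cons_measure A)%E.
Proof. by rewrite /cons_measure /pushforward measure_ge0. Qed.

Let cons_measure_sigma_additive : semi_sigma_additive cons_measure.
Proof.
exact: (@measure_semi_sigma_additive _ _ _
  (measure_function_pushforward__canonical__measure_function_Measure
    (prod_measure mu nu) measurable_cons_pair)).
Qed.

HB.instance Definition _ := isMeasure.Build _ _ _ cons_measure
  cons_measure0 cons_measure_ge0 cons_measure_sigma_additive.

Let cons_measure_fin : fin_num_fun cons_measure.
Proof.
apply: lty_fin_num_fun => /=.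
have -> : cons_measure setT = prod_measure mu nu setT by [].
by rewrite ltey_eq fin_num_measure.
Qed.

HB.instance Definition _ :=
  Measure_isFinite.Build _ _ _ cons_measure cons_measure_fin.

End Cons.

Fixpoint tuple_measure n : {finite_measure set (n.-tuple T) -> \bar R} :=
  if n is n'.+1 then cons_measure (tuple_measure n')
  else \d_([tuple] : 0.-tuple T).

End TupleMeasure.

(** * The torus *)

Section Circle.
Context (R : realType).

(* Functions on R/2piZ are identified with functions on R considered modulo
   equality almost everywhere for the Lebesgue measure restricted to the
   fundamental domain [0, 2pi]. The same measure is used for the time
   variable t in [0, 2pi]. *)
Definition circle_measure : set (measurableTypeR R) -> \bar R :=
  mrestr (@lebesgue_measure R) (measurable_itv `[0, 2 * pi]).

HB.instance Definition _ := Measure.on circle_measure.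

Let circle_measure_fin : fin_num_fun circle_measure.
Proof.
apply: lty_fin_num_fun => /=.
have -> : circle_measure setT = lebesgue_measure `[0, 2 * pi :> R].
  by rewrite /circle_measure /mrestr setTI.
by rewrite lebesgue_measure_itv/=; case: ifP; rewrite ?ltry.
Qed.

HB.instance Definition _ :=
  Measure_isFinite.Build _ _ _ circle_measure circle_measure_fin.

End Circle.

Notation torus R := (3.-tuple (measurableTypeR R)).
Notation Z3 := 'rV[int]_3.

(* The argument is the pair (x_1 .. x_k ; x'_1 .. x'_k). *)
Notation bikernel R k :=
  ((k.-tuple (torus R) * k.-tuple (torus R))%type -> R[i]).

Definition torus_measure (R : realType)
    : {finite_measure set (torus R) -> \bar R} :=
  tuple_measure (@circle_measure R) 3.

Definition conf_measure (R : realType) (k : nat)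
    : {finite_measure set (k.-tuple (torus R)) -> \bar R} :=
  tuple_measure (torus_measure R) k.

Definition kernel_measure (R : realType) (k : nat)
    : {finite_measure set (k.-tuple (torus R) * k.-tuple (torus R))%type
        -> \bar R} :=
  prod_measure (conf_measure R k) (conf_measure R k).

Definition spacetime_measure (R : realType) (k : nat)
    : {finite_measure set (measurableTypeR R *
        (k.-tuple (torus R) * k.-tuple (torus R)))%type -> \bar R} :=
  prod_measure (@circle_measure R) (kernel_measure R k).

(** * Complex-valued functions *)

Section ComplexFunctions.
Context d (T : measurableType d) (R : realType).
Variable mu : {measure set T -> \bar R}.

Definition cmeasurable (f : T -> R[i]) :=
  measurable_fun setT (fun x => complex.Re (f x)) /\
  measurable_fun setT (fun x => complex.Im (f x)).

Definition cintegral (f : T -> R[i]) : R[i] :=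
  (\int[mu]_x complex.Re (f x)) +i* (\int[mu]_x complex.Im (f x)).

Definition L2norm (f : T -> R[i]) : \bar R :=
  Lnorm mu 2%:E (fun x => (ComplexField.Normc.normc (f x))%:E).

Definition memL2 (f : T -> R[i]) := cmeasurable f /\ (L2norm f < +oo)%E.

End ComplexFunctions.

Definition expi (R : realType) (theta : R) : R[i] := cos theta +i* sin theta.

(* Unordered sum of a complex family; 0 if it is not absolutely summable. *)
Definition csum (R : realType) (I : choiceType) (f : I -> R[i]) : R[i] :=
  let rsum (g : I -> R) : R :=
    fine (\esum_(i in setT) (Num.max (g i) 0)%:E) -
    fine (\esum_(i in setT) (Num.max (- g i) 0)%:E) in
  if `[< summable setT (fun i => (ComplexField.Normc.normc (f i))%:E) >] then
    rsum (fun i => complex.Re (f i)) +i* rsum (fun i => complex.Im (f i))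
  else 0.

(** * Fourier series *)

Definition pairing (R : realType) (x : torus R) (n : Z3) : R :=
  \sum_(a < 3) tnth x a * (n 0 a)%:~R.

Definition sqnorm (R : realType) (n : Z3) : R := \sum_(a < 3) (n 0 a)%:~R ^+ 2.

(* A distribution on Lambda^k x Lambda^k, given by its Fourier transform. *)
Definition fdist (R : realType) (k : nat) :=
  k.-tuple Z3 -> k.-tuple Z3 -> R[i].

Definition fourier (R : realType) (k : nat) (f : bikernel R k) : fdist R k :=
  fun n n' => cintegral (kernel_measure R k) (fun z =>
    f z * expi (- (\sum_(j < k) pairing (tnth z.1 j) (tnth n j))
                + \sum_(j < k) pairing (tnth z.2 j) (tnth n' j))).

(* The L^2 norm of a distribution: +oo unless the distribution is a function,
   and then the norm of that function, which is unique almost everywhere. *)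
Definition dist_norm (R : realType) (k : nat) (c : fdist R k) : \bar R :=
  ereal_inf [set L2norm (kernel_measure R k) f |
    f in [set f : bikernel R k | cmeasurable f /\ fourier f = c]].

(* The same in L^2([0, 2pi] x Lambda^k x Lambda^k), for a time-dependent
   distribution. *)
Definition spacetime_norm (R : realType) (k : nat) (c : R -> fdist R k)
    : \bar R :=
  ereal_inf [set L2norm (spacetime_measure R k) u |
    u in [set u : measurableTypeR R * _ -> R[i] | cmeasurable u /\
      {ae @circle_measure R, forall t, fourier (fun z => u (t, z)) = c t}]].

(** * The operators of the hierarchy *)

Definition Sop (R : realType) (k : nat) (c : fdist R k) : fdist R k :=
  fun n n' => (\prod_(j < k) (Num.sqrt (1 + sqnorm R (tnth n j)) *
                              Num.sqrt (1 + sqnorm R (tnth n' j))))%:C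
              * c n n'.

Definition Uop (R : realType) (k : nat) (t : R) (c : fdist R k) : fdist R k :=
  fun n n' => expi (- (t * (\sum_(j < k) sqnorm R (tnth n j)
                            - \sum_(j < k) sqnorm R (tnth n' j))))
              * c n n'.

Definition shift_freq (k : nat) (j : 'I_k) (d : Z3) (n : k.-tuple Z3)
    : k.-tuple Z3 :=
  [tuple tnth n i + (if i == j then d else 0) | i < k].

(* The trace x_{k+1} = x'_{k+1} = x_j (resp. x'_j) on Fourier coefficients:
   the summation variable is p = (n_{k+1}, n'_{k+1}), and (2pi)^-6 is the
   constant produced by this normalization of the Fourier transform. Absolute
   summability is not affected by U(t), so the convention of [csum] for
   divergent series is applied at the same frequencies for all t. *)
Definition Bplus (R : realType) (k : nat) (j : 'I_k) (c : fdist R k.+1)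
    : fdist R k :=
  fun n n' => ((2 * pi) ^- 6)%:C * csum (fun p : Z3 * Z3 =>
    c [tuple of rcons (shift_freq j (- p.1 + p.2) n) p.1]
      [tuple of rcons n' p.2]).

Definition Bminus (R : realType) (k : nat) (j : 'I_k) (c : fdist R k.+1)
    : fdist R k :=
  fun n n' => ((2 * pi) ^- 6)%:C * csum (fun p : Z3 * Z3 =>
    c [tuple of rcons n p.1]
      [tuple of rcons (shift_freq j (p.1 - p.2) n') p.2]).

Definition Bop (R : realType) (k : nat) (j : 'I_k) (c : fdist R k.+1)
    : fdist R k :=
  fun n n' => Bplus j c n n' - Bminus j c n n'.

(** * Density matrices *)

Definition density_matrix (R : realType) (k : nat) (g : bikernel R k) :=
  [/\ memL2 (kernel_measure R k) g,
      {ae kernel_measure R k, forall z, g z = (g (z.2, z.1))^*} &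
      forall s : 'S_k, {ae kernel_measure R k, forall z,
        g ([tuple tnth z.1 (s i) | i < k], [tuple tnth z.2 (s i) | i < k])
        = g z}].

(* The k-particle density matrices are indexed by k >= 1; the value of the
   sequence at 0 plays no role. *)
Definition in_H1 (R : realType) (g : forall k, bikernel R k) :=
  forall k, (0 < k)%N -> density_matrix (g k) /\
    (dist_norm (Sop (fourier (g k))) < +oo)%E.

(* Main.v *)
Require Import Defs.
From mathcomp Require Import all_boot all_order all_algebra.
From mathcomp Require Import fingroup perm complex.
From mathcomp Require Import all_classical all_reals all_analysis.
From mathcomp Require Import measurable_realfun ring lra zify.

(** The estimate fails already for one particle, by a logarithm.

    On the Fourier side, the coefficient of [B^+ U(t) gamma] at [(n; n')] is the
    sum over [(p, p')] of the coefficients of [gamma] at [(n - p + p', p; n', p')],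
    each with the phase [|n - p + p'|^2 + |p|^2 - |n'|^2 - |p'|^2]. Take
    [n = (N, 0, 0)], [n' = 0], [p = 0] and [p' = r] orthogonal to [n]. By
    Pythagoras the phase is [|n + r|^2 - |r|^2 = N^2] for all such [r]: the
    resonant set contains a plane. If the coefficient of [gamma] at
    [(n + r, 0; 0, r)] is comparable to [1 / |r|^2] for [r] in a finite set of
    vectors of length at most [N], then

    - the coefficient of the trace at [(n; 0)] has a modulus independent of [t]
      and comparable to [H], the sum of [1 / |r|^2] over the set, so that the
      left-hand side of the estimate is at least of order [N * H];
    - the square of the right-hand side is of order the sum of
      [(1 + N^2) (1 + |r|^2) / |r|^4], that is [N^2 * H].

    The estimate would bound [sqrt H]; but [r] ranges over a two-dimensional
    lattice, where the sum of [1 / |r|^2] diverges logarithmically. Concretely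
    [r = (0, a, b)] with [1 <= b <= a <= M] and [N = 2 M], the coefficient is
    [1 / (4 a^2)], and [H] is the harmonic sum [series harmonic M].

    The example must also be a density matrix, so its frequencies are closed up
    under exchange of particles and Hermitian symmetry. The added frequencies do
    not contribute at [(n; 0)] ([Bplus_support]), nor does [B^-]
    ([Bminus_support]), which makes the coefficient exact ([Bop_coefficient]).

    Two facts transfer the computation with coefficients to norms. A
    trigonometric polynomial exhibits the right-hand side explicitly, by
    orthogonality of plane waves ([dist_norm_trig]); and a Fourier coefficient of
    constant modulus bounds the space-time norm from below, by Tonelli and
    Hoelder ([spacetime_norm_ge]), whichever function represents the left-hand
    side. *)

Set Implicit Arguments.
Unset Strict Implicit.
Unset Printing Implicit Defensive.
Import Order.TTheory GRing.Theory Num.Theory.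
Import numFieldNormedType.Exports.

Local Open Scope classical_set_scope.
Local Open Scope ring_scope.
Local Open Scope complex_scope.

Local Notation Re := complex.Re.
Local Notation Im := complex.Im.
Local Notation normc := ComplexField.Normc.normc.

(** * Complex numbers *)

Section ComplexNumbers.
Variable R : realType.
Implicit Types (x y : R[i]) (th : R).

Lemma Re_add x y : Re (x + y) = Re x + Re y.
Proof. by case: x; case: y. Qed.

Lemma Im_add x y : Im (x + y) = Im x + Im y.
Proof. by case: x; case: y. Qed.

Lemma Re_mul x y : Re (x * y) = Re x * Re y - Im x * Im y.
Proof. by case: x; case: y. Qed.

Lemma Im_mul x y : Im (x * y) = Re x * Im y + Im x * Re y.
Proof. by case: x => a b; case: y => c e /=. Qed.

Lemma conjcM x y : conjc (x * y) = conjc x * conjc y.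
Proof. exact: rmorphM. Qed.

Lemma conjc_sum (I : Type) (s : seq I) (F : I -> R[i]) :
  conjc (\sum_(i <- s) F i) = \sum_(i <- s) conjc (F i).
Proof. exact: rmorph_sum. Qed.

Lemma sqr_normcE x : normc x ^+ 2 = Re (x * conjc x).
Proof.
case: x => a b /=; rewrite sqr_sqrtr; last by rewrite addr_ge0 ?sqr_ge0.
by rewrite mulrN opprK !expr2.
Qed.

Lemma le_Re_normc (w : R[i]) : `|Re w| <= normc w.
Proof. by case: w => a b /=; rewrite -sqrtr_sqr ler_wsqrtr// lerDl sqr_ge0. Qed.

Lemma le_Im_normc (w : R[i]) : `|Im w| <= normc w.
Proof. by case: w => a b /=; rewrite -sqrtr_sqr ler_wsqrtr// lerDr sqr_ge0. Qed.

Lemma normc_ge0 (w : R[i]) : 0 <= normc w.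
Proof. exact: le_trans (normr_ge0 _) (le_Re_normc w). Qed.

Lemma normc_le_ReIm (w : R[i]) : normc w <= `|Re w| + `|Im w|.
Proof.
case: w => a b /=; rewrite -[leRHS]ger0_norm ?addr_ge0// -sqrtr_sqr ler_wsqrtr//.
rewrite sqrrD !real_normK ?num_real// lerD2r lerDl.
by rewrite mulrn_wge0// mulr_ge0.
Qed.

Lemma expi0 : expi 0 = 1 :> R[i].
Proof. by rewrite /expi cos0 sin0. Qed.

Lemma expiD (a b : R) : expi (a + b) = expi a * expi b.
Proof.
rewrite /expi cosD sinD /GRing.mul /=; congr (_ +i* _).
by rewrite addrC.
Qed.

Lemma expiN th : expi (- th) = conjc (expi th).
Proof. by rewrite /expi cosN sinN. Qed.

Lemma expi_sum (I : Type) (s : seq I) (F : I -> R) :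
  expi (\sum_(i <- s) F i) = \prod_(i <- s) expi (F i).
Proof.
elim: s => [|i s IH]; first by rewrite !big_nil expi0.
by rewrite !big_cons expiD IH.
Qed.

Lemma normc_expi th : normc (expi th) = 1.
Proof. by rewrite /= cos2Dsin2 sqrtr1. Qed.

End ComplexNumbers.

(** * Integrals of bounded complex functions *)

Section BoundedFunctions.
Context d (T : measurableType d) (R : realType).
Implicit Types f g : T -> R[i].

Lemma measurable_normc f : cmeasurable f -> measurable_fun setT (fun x => normc (f x)).
Proof.
move=> [m1 m2].
rewrite (_ : (fun x => _) = (fun x => Num.sqrt (Re (f x) ^+ 2 + Im (f x) ^+ 2))); last first.
  by apply/funext => x; case: (f x).
apply: (@measurableT_comp _ _ _ _ _ _ (@Num.sqrt R)).
  by apply: continuous_measurable_fun; exact: sqrt_continuous.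
by apply: measurable_funD; exact: measurable_funX.
Qed.

Lemma cmeasurableM f g : cmeasurable f -> cmeasurable g ->
  cmeasurable (fun x => f x * g x).
Proof.
move=> [mf1 mf2] [mg1 mg2]; split.
  by under eq_fun do rewrite Re_mul; apply: measurable_funB; exact: measurable_funM.
by under eq_fun do rewrite Im_mul; apply: measurable_funD; exact: measurable_funM.
Qed.

(** Bounded measurable functions are integrable for every finite measure and are
    stable under sums, products and measurable substitutions, so that linearity
    and Fubini apply to them without further integrability conditions. *)
Definition tame f := cmeasurable f /\
  exists M : R, forall x, `|Re (f x)| <= M /\ `|Im (f x)| <= M.

Lemma tame_cst (a : R[i]) : tame (fun=> a).
Proof.
split; first by split; exact: measurable_cst.
by exists (`|Re a| + `|Im a|) => x; rewrite lerDl lerDr !normr_ge0.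
Qed.

Lemma tameD f g : tame f -> tame g -> tame (fun x => f x + g x).
Proof.
move=> [[mf1 mf2] [M hM]] [[mg1 mg2] [N hN]]; split.
  split.
    by under eq_fun do rewrite Re_add; exact: measurable_funD.
  by under eq_fun do rewrite Im_add; exact: measurable_funD.
exists (M + N) => x; have [a b] := hM x; have [c e] := hN x.
by rewrite Re_add Im_add; split; apply: (le_trans (ler_normD _ _)); exact: lerD.
Qed.

Lemma tameM f g : tame f -> tame g -> tame (fun x => f x * g x).
Proof.
move=> [mf [M hM]] [mg [N hN]]; split; first exact: cmeasurableM.
exists (M * N + M * N) => x; have [a b] := hM x; have [c e] := hN x.
rewrite Re_mul Im_mul; split; (apply: (le_trans (ler_normD _ _)));
  rewrite ?normrN !normrM; by apply: lerD; apply: ler_pM.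
Qed.

Lemma tame_sum (I : Type) (s : seq I) (F : I -> T -> R[i]) :
  (forall i, tame (F i)) -> tame (fun x => \sum_(i <- s) F i x).
Proof.
move=> tF; elim: s => [|i s IH].
  by under eq_fun do rewrite big_nil; exact: tame_cst.
by under eq_fun do rewrite big_cons; exact: tameD.
Qed.

Lemma tame_prod (I : Type) (s : seq I) (F : I -> T -> R[i]) :
  (forall i, tame (F i)) -> tame (fun x => \prod_(i <- s) F i x).
Proof.
move=> tF; elim: s => [|i s IH].
  by under eq_fun do rewrite big_nil; exact: tame_cst.
by under eq_fun do rewrite big_cons; exact: tameM.
Qed.

Lemma tame_conjc f : tame f -> tame (fun x => conjc (f x)).
Proof.
move=> [[m1 m2] [M hM]]; split.
  split.
    by rewrite (_ : (fun x => _) = (fun x => Re (f x)))//; apply/funext => x; case: (f x).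
  rewrite (_ : (fun x => _) = (fun x => - Im (f x))); last by apply/funext => x; case: (f x).
  exact: measurable_funN.
by exists M => x; have := hM x; case: (f x) => a b /=; rewrite normrN.
Qed.

Lemma tame_expi (th : T -> R) :
  measurable_fun setT th -> tame (fun x => expi (th x)).
Proof.
move=> mth; split.
  by split; apply: (@measurableT_comp _ _ _ _ _ _ _ _ th) => //;
     apply: continuous_measurable_fun; [exact: continuous_cos|exact: continuous_sin].
exists 1 => x; split; rewrite /= ler_norml.
  by rewrite cos_geN1 cos_le1.
by rewrite sin_geN1 sin_le1.
Qed.

Section Integral.
Variable mu : {finite_measure set T -> \bar R}.

Lemma bounded_integrable (h : T -> R) (M : R) : measurable_fun setT h ->
  (forall x, `|h x| <= M) -> mu.-integrable setT (EFin \o h).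
Proof.
move=> mh hM; apply: measurable_bounded_integrable => //.
  by rewrite ltey_eq fin_num_measure.
by exists M; split; rewrite ?num_real// => N MN x _; exact: le_trans (hM x) (ltW MN).
Qed.

Lemma tame_intRe f : tame f -> mu.-integrable setT (EFin \o (fun x => Re (f x))).
Proof.
by move=> [[m1 m2] [M hM]]; apply: (@bounded_integrable _ M) => // x; have [] := hM x.
Qed.

Lemma tame_intIm f : tame f -> mu.-integrable setT (EFin \o (fun x => Im (f x))).
Proof.
by move=> [[m1 m2] [M hM]]; apply: (@bounded_integrable _ M) => // x; have [] := hM x.
Qed.

Lemma cintegralD f g : tame f -> tame g ->
  cintegral mu (fun x => f x + g x) = cintegral mu f + cintegral mu g.
Proof.
move=> tf tg; rewrite /cintegral.
under eq_Rintegral do rewrite Re_add.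
under [X in _ +i* X]eq_Rintegral do rewrite Im_add.
by rewrite !RintegralD//; (exact: tame_intRe || exact: tame_intIm).
Qed.

Lemma cintegralZ (a : R[i]) f : tame f ->
  cintegral mu (fun x => a * f x) = a * cintegral mu f.
Proof.
move=> tf; rewrite /cintegral.
under eq_Rintegral do rewrite Re_mul.
under [X in _ +i* X]eq_Rintegral do rewrite Im_mul.
have iR := tame_intRe tf; have iI := tame_intIm tf.
have Z (c : R) h : mu.-integrable setT (EFin \o h) ->
    mu.-integrable setT (EFin \o (fun x => c * h x)).
  by move=> ih; rewrite /comp; under eq_fun do rewrite EFinM; exact: integrableZl.
rewrite RintegralB ?RintegralD ?RintegralZl//; try exact: Z.
by case: a.
Qed.

Lemma cintegral_sum (I : Type) (s : seq I) (F : I -> T -> R[i]) :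
  (forall i, tame (F i)) ->
  cintegral mu (fun x => \sum_(i <- s) F i x) = \sum_(i <- s) cintegral mu (F i).
Proof.
move=> tF; elim: s => [|i s IH].
  rewrite big_nil /cintegral.
  under eq_Rintegral do rewrite big_nil.
  under [X in _ +i* X]eq_Rintegral do rewrite big_nil.
  by rewrite /= Rintegral_cst// mul0r.
rewrite big_cons -IH -cintegralD//; last exact: tame_sum.
by congr cintegral; apply/funext => x; rewrite big_cons.
Qed.

Lemma cintegral_cst (a : R[i]) :
  cintegral mu (fun=> a) = a * (fine (mu setT))%:C.
Proof.
rewrite /cintegral !Rintegral_cst//.
by case: a => x y; rewrite /= /GRing.mul /= !mulr0 subr0 add0r.
Qed.

End Integral.
End BoundedFunctions.

Lemma tame_comp (R : realType) d d' (T : measurableType d)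
    (T' : measurableType d') (h : T' -> T) (f : T -> R[i]) :
  measurable_fun setT h -> tame f -> tame (fun x => f (h x)).
Proof.
move=> mh [[mf1 mf2] [M hM]]; split; last by exists M => y; exact: hM.
by split; [exact: (measurableT_comp mf1)|exact: (measurableT_comp mf2)].
Qed.

Section Fubini.
Context d1 d2 (T1 : measurableType d1) (T2 : measurableType d2) (R : realType).
Variables (mu : {finite_measure set T1 -> \bar R}).
Variables (nu : {finite_measure set T2 -> \bar R}).

Lemma Rintegral_prod (f : T1 -> R) (g : T2 -> R) (M N : R) :
  measurable_fun setT f -> measurable_fun setT g ->
  (forall x, `|f x| <= M) -> (forall x, `|g x| <= N) ->
  \int[prod_measure mu nu]_z (f z.1 * g z.2) = (\int[mu]_x f x) * (\int[nu]_y g y).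
Proof.
move=> mf mg fM gN.
have mfg : measurable_fun setT (fun z : T1 * T2 => f z.1 * g z.2).
  by apply: measurable_funM; apply: measurableT_comp.
have ifg : (prod_measure mu nu).-integrable setT
    (EFin \o (fun z : T1 * T2 => f z.1 * g z.2)).
  apply: (@bounded_integrable _ _ _ (prod_measure mu nu) _ (M * N)) => // z.
  by rewrite normrM ler_pM.
have if_ := bounded_integrable mu mf fM; have ig := bounded_integrable nu mg gN.
rewrite {1}/Rintegral.
transitivity (fine (\int[mu]_x \int[nu]_y (f x * g y)%:E)%E).
  by congr fine; rewrite [RHS](@integral12_prod_meas1 _ _ _ _ _ mu nu
    (EFin \o (fun z : T1 * T2 => f z.1 * g z.2))).
have E x : (\int[nu]_y (f x * g y)%:E = (f x * \int[nu]_y g y)%:E)%E.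
  under eq_integral do rewrite EFinM.
  rewrite integralZl// EFinM /Rintegral fineK//.
  exact: (integrable_fin_num measurableT ig).
under eq_integral do rewrite E.
by rewrite -/(Rintegral mu setT (fun x => f x * _)) RintegralZr.
Qed.

(** Separate Fubini in the real and imaginary parts: each of the four real
    products in [f z.1 * g z.2] splits into two factors. *)
Lemma cintegral_prod (f : T1 -> R[i]) (g : T2 -> R[i]) : tame f -> tame g ->
  cintegral (prod_measure mu nu) (fun z => f z.1 * g z.2) =
  cintegral mu f * cintegral nu g.
Proof.
move=> tf tg.
case: (tf) => [[mf1 mf2] [M hM]]; case: (tg) => [[mg1 mg2] [N hN]].
have fM1 x : `|Re (f x)| <= M by have [] := hM x.
have fM2 x : `|Im (f x)| <= M by have [] := hM x.
have gN1 x : `|Re (g x)| <= N by have [] := hN x.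
have gN2 x : `|Im (g x)| <= N by have [] := hN x.
have I (p : T1 -> R) (q : T2 -> R) : measurable_fun setT p ->
    measurable_fun setT q -> (forall x, `|p x| <= M) -> (forall x, `|q x| <= N) ->
    (prod_measure mu nu).-integrable setT
    (EFin \o (fun z : T1 * T2 => p z.1 * q z.2)).
  move=> mp mq pM qN.
  apply: (@bounded_integrable _ _ _ (prod_measure mu nu) _ (M * N)) => [|z].
    by apply: measurable_funM; apply: measurableT_comp.
  by rewrite normrM ler_pM.
rewrite /cintegral.
under eq_Rintegral do rewrite Re_mul.
under [X in _ +i* X]eq_Rintegral do rewrite Im_mul.
have I11 := I _ _ mf1 mg1 fM1 gN1; have I22 := I _ _ mf2 mg2 fM2 gN2.
have I12 := I _ _ mf1 mg2 fM1 gN2; have I21 := I _ _ mf2 mg1 fM2 gN1.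
rewrite RintegralB// RintegralD//.
rewrite (@Rintegral_prod _ _ M N mf1 mg1)// (@Rintegral_prod _ _ M N mf2 mg2)//.
by rewrite (@Rintegral_prod _ _ M N mf1 mg2)// (@Rintegral_prod _ _ M N mf2 mg1).
Qed.

End Fubini.

Section TupleIntegral.
Context d (T : measurableType d) (R : realType).
Variables (mu : {finite_measure set T -> \bar R}).

Lemma Rintegral_cons (n : nat) (nu : {finite_measure set (n.-tuple T) -> \bar R})
    (f : n.+1.-tuple T -> R) (M : R) :
  measurable_fun setT f -> (forall x, `|f x| <= M) ->
  \int[cons_measure mu nu]_x f x =
  \int[prod_measure mu nu]_z f (cons_pair z).
Proof.
move=> mf fM; rewrite /Rintegral; congr fine.
rewrite (@integral_pushforward _ _ _ _ R _ (@measurable_cons_pair _ T n)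
  (prod_measure mu nu) setT (EFin \o f))//.
- exact/measurable_EFinP.
- rewrite preimage_setT.
  apply: (@bounded_integrable _ _ _ (prod_measure mu nu) _ M) => //.
  by apply: measurableT_comp => //; exact: measurable_cons_pair.
Qed.

(** Iterating Fubini along the recursive construction of the tuple measure. It is
    applied twice: to the three coordinates of a point of the torus, and to the
    particles of a configuration. *)
Lemma cintegral_tuple n (F : 'I_n -> T -> R[i]) : (forall j, tame (F j)) ->
  cintegral (tuple_measure mu n) (fun x => \prod_(j < n) F j (tnth x j)) =
  \prod_(j < n) cintegral mu (F j).
Proof.
elim: n F => [|n IH] F tF.
  rewrite big_ord0; under eq_fun do rewrite big_ord0.
  rewrite cintegral_cst mul1r.
  by have -> : tuple_measure mu 0 setT = 1%E by exact: (@diracT _ _ R).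
have tP : tame (fun x : n.+1.-tuple T => \prod_(j < n.+1) F j (tnth x j)).
  by apply: tame_prod => j; apply: tame_comp => //; exact: measurable_tnth.
have [[m1 m2] [M hM]] := tP.
rewrite big_ord_recl -IH// -cintegral_prod//; last first.
  by apply: tame_prod => j; apply: tame_comp => //; exact: measurable_tnth.
have E (z : T * n.-tuple T) : \prod_(j < n.+1) F j (tnth (cons_pair z) j) =
    F ord0 z.1 * \prod_(j < n) F (lift ord0 j) (tnth z.2 j).
  rewrite big_ord_recl tnth0; congr (_ * _).
  by apply: eq_bigr => j _; rewrite tnthS.
rewrite /cintegral /= (@Rintegral_cons _ _ _ M)//; last by move=> x; have [] := hM x.
rewrite (@Rintegral_cons _ _ _ M)//; last by move=> x; have [] := hM x.
by under eq_Rintegral do rewrite E; under [X in _ +i* X]eq_Rintegral do rewrite E.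
Qed.

End TupleIntegral.

(** * Orthogonality of plane waves *)

Section CircleIntegral.
Variable R : realType.

(** The circle measure is carried by [0, 2pi], so the fundamental theorem of
    calculus computes the integral of a derivative. *)
Lemma circle_FTC (f F : R -> R) (M : R) :
  (forall x : R, is_derive x 1 F (f x)) -> continuous f -> (forall x, `|f x| <= M) ->
  \int[@circle_measure R]_x f x = F (2 * pi) - F 0.
Proof.
move=> dF cf fM.
have cF : continuous F.
  move=> x; apply/differentiable_continuous/derivable1_diffP.
  by have [] := dF x.
have pi2 : 0 < 2 * pi :> R by rewrite mulr_gt0 ?pi_gt0.
rewrite /Rintegral.
have ifc : (@circle_measure R).-integrable setT (EFin \o f).
  apply: (@bounded_integrable _ _ _ (@circle_measure R) _ M) => //.
  exact: continuous_measurable_fun.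
rewrite (@negligible_integral _ _ _ (@circle_measure R) setT (~` `[0, 2 * pi]))//.
- rewrite setDE setCK setTI (eq_measure_integral (@lebesgue_measure R)).
    rewrite (@continuous_FTC2 _ f F)//.
    + exact: continuous_subspaceT.
    + split.
      * by move=> x _; have [] := dF x.
      * by apply: cvg_at_right_filter; exact: cF.
      * by apply: cvg_at_left_filter; exact: cF.
    + by move=> x _; rewrite derive1E; apply: derive_val.
  by move=> A mA A02; rewrite /= /circle_measure /mrestr setIidl.
- exact: measurableC.
- by rewrite /= /circle_measure /mrestr setICl measure0.
Qed.

Lemma cos_2pi_int (m : int) : cos (2 * pi * m%:~R) = 1 :> R.
Proof.
have H n : cos (2 * pi * n%:R) = 1 :> R.
  have := periodicn (@cosD2pi R) n 0; rewrite add0r cos0.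
  by rewrite mulr_natr mulr_natl.
by case: m => n; rewrite -?pmulrn ?NegzE ?rmorphN /= ?mulrN ?cosN H.
Qed.

Lemma sin_2pi_int (m : int) : sin (2 * pi * m%:~R) = 0 :> R.
Proof.
have H n : sin (2 * pi * n%:R) = 0 :> R.
  have := periodicn (@sinD2pi R) n 0; rewrite add0r sin0.
  by rewrite mulr_natr mulr_natl.
by case: m => n; rewrite -?pmulrn ?NegzE ?rmorphN /= ?mulrN ?sinN H ?oppr0.
Qed.

Lemma circle_measureT : circle_measure setT = (2 * pi : R)%:E.
Proof.
rewrite /circle_measure /mrestr setTI /= lebesgue_measure_itv /= lte_fin.
by rewrite mulr_gt0 ?pi_gt0// oppr0 adde0.
Qed.

Lemma cintegral_circle (m : int) :
  cintegral (@circle_measure R) (fun x : R => expi (x * m%:~R)) =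
  (2 * pi * (m == 0)%:R)%:C.
Proof.
case: eqVneq => [->|m0].
  rewrite mulr1; under eq_fun do rewrite mulr0 /expi cos0 sin0.
  rewrite cintegral_cst mul1r; congr (_%:C); exact: (congr1 fine circle_measureT).
have m0' : m%:~R != 0 :> R by rewrite intr_eq0.
rewrite mulr0 /cintegral /=.
have dm (x : R) : is_derive x 1 (fun y : R => y * m%:~R) m%:~R.
  by apply: is_derive_eq; rewrite /= scaler0 add0r /GRing.scale /= mulr1.
have cm : continuous (fun y : R => y * m%:~R) by move=> x; exact: mulrr_continuous.
have Ec : \int[@circle_measure R]_x cos (x * m%:~R) =
    sin (2 * pi * m%:~R) / m%:~R - sin (0 * m%:~R) / m%:~R.
  apply: (@circle_FTC _ (fun x => sin (x * m%:~R) / m%:~R) 1) => [x|x|x].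
  - apply: is_derive_eq.
    by rewrite /GRing.scale /= !mulr0 add0r ?mulNr ?opprK mulrC mulfK.
  - by apply: continuous_comp; [exact: cm|exact: continuous_cos].
  - by rewrite ler_norml cos_geN1 cos_le1.
have Es : \int[@circle_measure R]_x sin (x * m%:~R) =
    - cos (2 * pi * m%:~R) / m%:~R - - cos (0 * m%:~R) / m%:~R.
  apply: (@circle_FTC _ (fun x => - cos (x * m%:~R) / m%:~R) 1) => [x|x|x].
  - apply: is_derive_eq.
    by rewrite /GRing.scale /= !mulr0 add0r ?mulNr ?opprK mulrC mulfK.
  - by apply: continuous_comp; [exact: cm|exact: continuous_sin].
  - by rewrite ler_norml sin_geN1 sin_le1.
rewrite Ec Es.
by rewrite sin_2pi_int cos_2pi_int !mul0r sin0 cos0 mul0r !subrr.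
Qed.

End CircleIntegral.

Section Waves.
Variable R : realType.

Lemma measurable_pairing (n : Z3) : measurable_fun setT (fun x : torus R => pairing x n).
Proof.
apply: measurable_sum => a; apply: measurable_funM => //.
exact: measurable_tnth.
Qed.

(** Frequencies are a function rather than a tuple, to make subtraction pointwise. *)
Definition confphase k (x : k.-tuple (torus R)) (n : 'I_k -> Z3) : R :=
  \sum_(j < k) pairing (tnth x j) (n j).

Lemma measurable_confphase k (n : 'I_k -> Z3) :
  measurable_fun setT (fun x => confphase x n).
Proof.
apply: measurable_sum => j; apply: (@measurableT_comp _ _ _ _ _ _ (fun x => pairing x (n j))).
  exact: measurable_pairing.
exact: measurable_tnth.
Qed.

Lemma cintegral_torus (n : Z3) :
  cintegral (torus_measure R) (fun x => expi (pairing x n)) =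
  ((2 * pi) ^+ 3 * (n == 0)%:R)%:C.
Proof.
under eq_fun do rewrite /pairing expi_sum.
rewrite [LHS](@cintegral_tuple _ (measurableTypeR R) R (@circle_measure R) 3
  (fun a x => expi (x * (n 0 a)%:~R))); last first.
  by move=> a; apply: tame_expi; exact: measurable_funM.
under eq_bigr do rewrite cintegral_circle.
rewrite -rmorph_prod /=; congr (_%:C).
case: eqVneq => [->|n0].
  under eq_bigr do rewrite mxE eqxx mulr1.
  by rewrite prodr_const card_ord mulr1.
rewrite mulr0; have [a na] : exists a, n 0 a != 0.
  apply/existsP; apply: contra_neqT n0 => /existsPn H.
  by apply/rowP => a; rewrite mxE; apply/eqP; move: (H a); rewrite negbK.
by rewrite (bigD1 a)//= (negbTE na) mulr0 mul0r.
Qed.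

Lemma cintegral_conf k (n : 'I_k -> Z3) :
  cintegral (conf_measure R k) (fun x => expi (confphase x n)) =
  ((2 * pi) ^+ (3 * k) * [forall j, n j == 0]%:R)%:C.
Proof.
under eq_fun do rewrite /confphase expi_sum.
rewrite [LHS](@cintegral_tuple _ (torus R) R (torus_measure R) k
  (fun j x => expi (pairing x (n j)))); last first.
  by move=> a; apply: tame_expi; exact: measurable_pairing.
under eq_bigr do rewrite cintegral_torus.
rewrite -rmorph_prod /=; congr (_%:C).
case: (boolP [forall j, n j == 0]) => [/forallP n0|/forallPn[j nj]].
  under eq_bigr do rewrite n0 mulr1.
  by rewrite prodr_const card_ord mulr1 exprM.
by rewrite mulr0 (bigD1 j)//= (negbTE nj) mulr0 mul0r.
Qed.

(** The plane waves are normalised so that the Fourier coefficient at [q] is the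
    inner product with [wave q]; this is where the opposite signs on the primed
    and unprimed variables come from. *)
Definition wave k (q : k.-tuple Z3 * k.-tuple Z3)
    (z : k.-tuple (torus R) * k.-tuple (torus R)) : R[i] :=
  expi (confphase z.1 (tnth q.1) - confphase z.2 (tnth q.2)).

Lemma pairingB (x : torus R) (m n : Z3) : pairing x (m - n) = pairing x m - pairing x n.
Proof.
rewrite /pairing -sumrB; apply: eq_bigr => a _.
by rewrite !mxE rmorphB /= mulrBr.
Qed.

Lemma confphaseB k (x : k.-tuple (torus R)) (m n : 'I_k -> Z3) :
  confphase x (fun j => m j - n j) = confphase x m - confphase x n.
Proof. by rewrite /confphase -sumrB; apply: eq_bigr => a _; rewrite pairingB. Qed.

Lemma tame_wave k (q : k.-tuple Z3 * k.-tuple Z3) : tame (wave q).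
Proof.
apply: tame_expi; apply: measurable_funB.
  exact: (measurableT_comp (measurable_confphase (tnth q.1)) measurable_fst).
exact: (measurableT_comp (measurable_confphase (tnth q.2)) measurable_snd).
Qed.

Lemma fourierE k (f : bikernel R k) n n' :
  fourier f n n' = cintegral (kernel_measure R k) (fun z => f z * conjc (wave (n, n') z)).
Proof.
rewrite /fourier; congr cintegral; apply/funext => z; congr (_ * _).
by rewrite /wave -expiN opprB addrC.
Qed.

(** Orthogonality: the phase of the product is a linear form in the difference of
    the frequencies, its exponential is a product of one-dimensional waves, and a
    nonzero frequency in any of the coordinates makes the integral vanish. *)
Lemma cintegral_waves k (p q : k.-tuple Z3 * k.-tuple Z3) :
  cintegral (kernel_measure R k) (fun z => wave p z * conjc (wave q z)) =
  ((2 * pi) ^+ (6 * k) * (p == q)%:R)%:C.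
Proof.
have E z : wave p z * conjc (wave q z) =
    expi (confphase z.1 (fun j => tnth p.1 j - tnth q.1 j)) *
    expi (confphase z.2 (fun j => tnth q.2 j - tnth p.2 j)).
  rewrite /wave -expiN -!expiD !confphaseB; congr expi; ring.
under eq_fun do rewrite E.
rewrite (@cintegral_prod _ _ _ _ R _ _
   (fun x => expi (confphase x (fun j => tnth p.1 j - tnth q.1 j)))
   (fun x => expi (confphase x (fun j => tnth q.2 j - tnth p.2 j)))); last 2 first.
- by apply: tame_expi; exact: measurable_confphase.
- by apply: tame_expi; exact: measurable_confphase.
rewrite !cintegral_conf -rmorphM /=; congr (_%:C).
rewrite mulrACA -exprD -mulnDl -natrM mulnb; congr (_ * (nat_of_bool _)%:R).
have T (m n : k.-tuple Z3) : [forall j, tnth m j - tnth n j == 0] = (m == n).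
  apply/forallP/eqP => [H|-> j]; last by rewrite subrr.
  by apply/eq_from_tnth => j; apply/eqP; rewrite -subr_eq0.
by rewrite !T [q.2 == _]eq_sym -xpair_eqE -!surjective_pairing.
Qed.

End Waves.

(** * Trigonometric polynomials *)

Section FiniteSums.
Variables (R : realType) (I : choiceType).

Lemma esum_seq (s : seq I) (g : I -> R) : uniq s ->
  (forall i, 0 <= g i) -> (forall i, i \notin s -> g i = 0) ->
  (\esum_(i in setT) (g i)%:E = (\sum_(i <- s) g i)%:E)%E.
Proof.
move=> us g0 gs.
transitivity (\esum_(i in [set` s]) (g i)%:E)%E.
  rewrite [RHS]esum_mkcond; apply: eq_esum => i _.
  by rewrite mem_setE; case: ifPn => // /gs ->.
rewrite esum_fset//; last by move=> i _; rewrite lee_fin.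
by rewrite -fsbig_seq// sumEFin.
Qed.

(** The convention for divergent series never interferes for the data considered
    here: they have finitely many nonzero Fourier coefficients. *)
Lemma csum_seq (s : seq I) (f : I -> R[i]) : uniq s ->
  (forall i, i \notin s -> f i = 0) -> csum f = \sum_(i <- s) f i.
Proof.
move=> us fs.
have N0 i : 0 <= normc (f i) by case: (f i) => a b; rewrite sqrtr_ge0.
have Ns i : i \notin s -> normc (f i) = 0.
  by move=> /fs ->; rewrite ComplexField.Normc.normc0.
have summ : summable setT (fun i => (normc (f i))%:E).
  rewrite /summable; under eq_esum do rewrite gee0_abs ?lee_fin//.
  by rewrite (@esum_seq s)// ltry.
have rs (g : I -> R) : (forall i, i \notin s -> g i = 0) ->
    fine (\esum_(i in setT) (Num.max (g i) 0)%:E)%E -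
    fine (\esum_(i in setT) (Num.max (- g i) 0)%:E)%E = \sum_(i <- s) g i.
  move=> gs; rewrite !(@esum_seq s)//=.
  - rewrite -sumrB; apply: eq_bigr => i _.
    rewrite !maxEle oppr_le0; case: ltrgt0P => ?; rewrite ?subr0 ?sub0r ?opprK//.
  - by move=> i; rewrite le_max lexx orbT.
  - by move=> i /gs ->; rewrite oppr0 maxxx.
  - by move=> i; rewrite le_max lexx orbT.
  - by move=> i /gs ->; rewrite maxxx.
rewrite /csum asboolT// !rs; last 2 first.
- by move=> i /fs ->.
- by move=> i /fs ->.
elim: s {us fs Ns rs} => [|i s IH]; first by rewrite !big_nil.
by rewrite !big_cons -IH; case: (f i).
Qed.

End FiniteSums.

Lemma perm_eq_map_self (I : eqType) (s : seq I) (h : I -> I) : uniq s ->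
  injective h -> (forall q, q \in s -> h q \in s) -> perm_eq (map h s) s.
Proof.
move=> us hi hs; have uh : uniq (map h s) by rewrite map_inj_uniq.
have sub : {subset map h s <= s} by move=> q /mapP[p ps ->]; exact: hs.
have le_sz : (size s <= size (map h s))%N by rewrite size_map.
by have [_] := uniq_min_size uh sub le_sz; exact: uniq_perm.
Qed.

Section Trig.
Variables (R : realType) (k : nat).
Notation freq := (k.-tuple Z3 * k.-tuple Z3)%type.
Implicit Types (s : seq freq) (c : freq -> R) (q : freq).

Definition trig s c : bikernel R k := fun z => \sum_(q <- s) (c q)%:C * wave q z.

Lemma tame_trig s c : tame (trig s c).
Proof.
by apply: tame_sum => q; apply: tameM; [exact: tame_cst|exact: tame_wave].
Qed.

Lemma fourier_trig s c : uniq s ->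
  fourier (trig s c) =
  (fun n n' => ((2 * pi) ^+ (6 * k) * (if (n, n') \in s then c (n, n') else 0))%:C).
Proof.
move=> us; apply/funext => n; apply/funext => n'.
rewrite fourierE /trig.
under eq_fun do rewrite mulr_suml.
have tw (q : freq) : tame (fun z => wave q z * conjc (wave (n, n') z) : R[i]).
  by apply: tameM; [exact: tame_wave|apply: tame_conjc; exact: tame_wave].
have tcw (q : freq) : tame (fun z => (c q)%:C * wave q z * conjc (wave (n, n') z) : R[i]).
  by under eq_fun do rewrite -mulrA; apply: tameM => //; exact: tame_cst.
rewrite cintegral_sum//.
have E q : cintegral (kernel_measure R k)
      (fun z => (c q)%:C * wave q z * conjc (wave (n, n') z)) =
    ((2 * pi) ^+ (6 * k) * (if q == (n, n') then c q else 0))%:C.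
  under eq_fun do rewrite -mulrA.
  rewrite cintegralZ// cintegral_waves -rmorphM /=; congr (_%:C).
  by case: eqP => _; rewrite ?mulr1 ?mulr0// mulrC.
under eq_bigr do rewrite E.
rewrite -rmorph_sum /= -mulr_sumr; congr ((_ * _)%:C).
rewrite -big_mkcond /=; case: ifPn => [ns|ns].
  rewrite big_mkcond (bigD1_seq (n, n'))//= eqxx big1 ?addr0// => q.
  by case: eqP.
by rewrite big_seq_cond big1// => q /andP[+ /eqP qn]; rewrite qn (negbTE ns).
Qed.

(** Parseval for trigonometric polynomials. Expanding only the conjugate factor
    of the squared modulus leaves Fourier coefficients of the other one. *)
Lemma L2norm_trig s c : uniq s ->
  L2norm (kernel_measure R k) (trig s c) =
  (Num.sqrt ((2 * pi) ^+ (6 * k) * \sum_(q <- s) c q ^+ 2))%:E.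
Proof.
move=> us.
have p0 : 0 <= (2 * pi : R) ^+ (6 * k).
  by rewrite exprn_ge0// mulr_ge0// pi_ge0.
have tt : tame (fun z => trig s c z * conjc (trig s c z)).
  by apply: tameM; [exact: tame_trig|apply: tame_conjc; exact: tame_trig].
have twt (q : freq) : tame (fun z => trig s c z * conjc (wave q z)).
  by apply: tameM; [exact: tame_trig|apply: tame_conjc; exact: tame_wave].
have Ec : cintegral (kernel_measure R k)
      (fun z => trig s c z * conjc (trig s c z)) =
    ((2 * pi) ^+ (6 * k) * \sum_(q <- s) c q ^+ 2)%:C.
  have E z : trig s c z * conjc (trig s c z) =
      \sum_(q <- s) (c q)%:C * (trig s c z * conjc (wave q z)).
    rewrite {2}/trig conjc_sum mulr_sumr; apply: eq_bigr => q _.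
    by rewrite conjcM conjc_real mulrCA.
  under eq_fun do rewrite E.
  rewrite cintegral_sum; last by move=> q; apply: tameM => //; exact: tame_cst.
  rewrite mulr_sumr rmorph_sum /= [LHS]big_seq [RHS]big_seq; apply: eq_bigr => q qs.
  rewrite cintegralZ; last exact: twt.
  have -> : cintegral (kernel_measure R k) (fun z => trig s c z * conjc (wave q z)) =
      fourier (trig s c) q.1 q.2 by rewrite fourierE -surjective_pairing.
  rewrite fourier_trig// -surjective_pairing qs -rmorphM /=; congr (_%:C).
  by rewrite mulrCA expr2.
transitivity ((\int[kernel_measure R k]_x
    (Re (trig s c x * conjc (trig s c x)))%:E) `^ 2^-1)%E.
  rewrite /L2norm unlock; congr poweR.
  apply: eq_integral => z _; rewrite abse_EFin poweR_EFin; congr (_%:E).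
  by rewrite powR_mulrn// real_normK ?num_real// sqr_normcE.
have {}Ec : \int[kernel_measure R k]_x Re (trig s c x * conjc (trig s c x)) =
  (2 * pi) ^+ (6 * k) * \sum_(q <- s) c q ^+ 2 := congr1 (@complex.Re R) Ec.
have fi : (\int[kernel_measure R k]_x
    (Re (trig s c x * conjc (trig s c x)))%:E \is a fin_num)%E.
  exact: (integrable_fin_num measurableT (tame_intRe _ tt)).
rewrite -(fineK fi) [fine _]Ec poweR_EFin powR12_sqrt// mulr_ge0// sumr_ge0//.
by move=> q _; exact: sqr_ge0.
Qed.

(** The Fourier multiplier of the operator [Sop]. *)
Definition weight q : R :=
  \prod_(j < k) (Num.sqrt (1 + sqnorm R (tnth q.1 j)) *
                 Num.sqrt (1 + sqnorm R (tnth q.2 j))).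

Lemma Sop_fourier_trig s c : uniq s ->
  Sop (fourier (trig s c)) = fourier (trig s (fun q => weight q * c q)).
Proof.
move=> us; rewrite !fourier_trig//; apply/funext => n; apply/funext => n'.
rewrite /Sop -rmorphM /= mulrCA; congr ((_ * _)%:C).
by case: ifP => // _; rewrite mulr0.
Qed.

(** The polynomial with coefficients [weight q * c q] is a function with the
    required Fourier coefficients; its norm bounds the infimum that defines
    [dist_norm]. *)
Lemma dist_norm_trig s c : uniq s ->
  (dist_norm (Sop (fourier (trig s c))) <=
   (Num.sqrt ((2 * pi) ^+ (6 * k) * \sum_(q <- s) (weight q * c q) ^+ 2))%:E)%E.
Proof.
move=> us; rewrite -L2norm_trig//; apply: ereal_inf_lbound.
exists (trig s (fun q => weight q * c q)) => //; split.
  by have [] := tame_trig s (fun q => weight q * c q).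
by rewrite Sop_fourier_trig.
Qed.

(** A symmetry of the set of frequencies and of the coefficients can be moved
    onto the waves. Applied to [swap_freq] and to [perm_freq], it gives the
    Hermitian and the bosonic symmetry of a trigonometric polynomial. *)
Lemma trig_reindex s c (h : freq -> freq) (F : freq -> R[i]) : uniq s ->
  injective h -> (forall q, q \in s -> h q \in s /\ c (h q) = c q) ->
  \sum_(q <- s) (c q)%:C * F (h q) = \sum_(q <- s) (c q)%:C * F q.
Proof.
move=> us hi hs.
have P : perm_eq (map h s) s.
  by apply: perm_eq_map_self => // q /hs[].
rewrite -[RHS](perm_big _ P) big_map [LHS]big_seq [RHS]big_seq.
by apply: eq_bigr => q /hs[_ ->].
Qed.

Definition perm_freq (t : 'S_k) q : freq :=
  ([tuple tnth q.1 (t i) | i < k], [tuple tnth q.2 (t i) | i < k]).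

Definition swap_freq q : freq := (q.2, q.1).

Lemma wave_swap q z : conjc (wave q (z.2, z.1)) = wave (swap_freq q) z :> R[i].
Proof. by rewrite /wave -expiN opprB. Qed.

Lemma wave_perm (t : 'S_k) q (z : k.-tuple (torus R) * k.-tuple (torus R)) :
  wave q ([tuple tnth z.1 (t i) | i < k], [tuple tnth z.2 (t i) | i < k]) =
  wave (perm_freq t^-1%g q) z.
Proof.
have E (x : k.-tuple (torus R)) (n : k.-tuple Z3) :
    confphase [tuple tnth x (t i) | i < k] (tnth n) =
    confphase x (tnth [tuple tnth n (t^-1%g i) | i < k]).
  rewrite /confphase [RHS](reindex_inj (@perm_inj _ t)) /=.
  by apply: eq_bigr => i _; rewrite !tnth_mktuple permK.
by rewrite /wave /= !E.
Qed.

Lemma perm_freq_inj (t : 'S_k) : injective (perm_freq t).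
Proof.
move=> [m m'] [n n'] [E1 E2].
have C (x y : k.-tuple Z3) :
    [tuple tnth x (t i) | i < k] = [tuple tnth y (t i) | i < k] -> x = y.
  move=> E; apply/eq_from_tnth => i.
  by have := congr1 (fun u => tnth u (t^-1%g i)) E; rewrite !tnth_mktuple permKV.
congr (_, _); apply: C; apply: val_inj => //=.
Qed.

Lemma density_matrix_trig s c : uniq s ->
  (forall q, q \in s -> swap_freq q \in s /\ c (swap_freq q) = c q) ->
  (forall (t : 'S_k) q, q \in s -> perm_freq t q \in s /\ c (perm_freq t q) = c q) ->
  density_matrix (trig s c).
Proof.
move=> us hs hp; split.
- split; first by have [] := tame_trig s c.
  by rewrite L2norm_trig// ltry.
- apply: aeW => z; rewrite /trig conjc_sum -(@trig_reindex _ _ swap_freq)//.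
    by apply: eq_bigr => q _; rewrite conjcM conjc_real wave_swap.
  by move=> [m m'] [n n'] [-> ->].
- move=> t; apply: aeW => z; rewrite /trig.
  under eq_bigr do rewrite wave_perm.
  rewrite (@trig_reindex _ _ (perm_freq t^-1%g) (fun q => wave q z))//.
    exact: perm_freq_inj.
  exact: hp.
Qed.

End Trig.

(** * Lower bound for the space-time norm *)

Section NormInequalities.
Context d (T : measurableType d) (R : realType).
Variable mu : {measure set T -> \bar R}.
Implicit Types f : T -> R[i].

(** The crude factor 2, from treating the real and imaginary parts separately, is
    harmless since constants do not matter. An infinite integral has [fine] value
    0, for which the bound is trivial. *)
Lemma normc_cintegral_le f : cmeasurable f ->
  ((normc (cintegral mu f))%:E <= 2%:E * \int[mu]_x (normc (f x))%:E)%E.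
Proof.
move=> mf; have mN := measurable_normc mf; have [m1 m2] := mf.
have B (h : T -> R) : measurable_fun setT h -> (forall x, `|h x| <= normc (f x)) ->
    ((`| \int[mu]_x h x |)%:E <= \int[mu]_x (normc (f x))%:E)%E.
  move=> mh hf; apply: (@le_trans _ _ (\int[mu]_x `|(h x)%:E|)%E).
    apply: (@le_trans _ _ `|\int[mu]_x (h x)%:E|%E).
      by rewrite /Rintegral; case: (\int[mu]_x _)%E => [r| |] //=;
         rewrite ?normr0 ?leey.
    by apply: le_abse_integral => //; exact/measurable_EFinP.
  apply: ge0_le_integral => //.
  - by apply: measurableT_comp => //; exact/measurable_EFinP.
  - exact/measurable_EFinP.
  - by move=> x _; rewrite lee_fin.
apply: (@le_trans _ _ (`|\int[mu]_x Re (f x)|%:E + `|\int[mu]_x Im (f x)|%:E)%E).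
  by rewrite -EFinD lee_fin; exact: (normc_le_ReIm (_ +i* _)).
rewrite [X in (X * _)%E](_ : _ = (1 + 1)%E) // ge0_muleDl// mul1e.
by apply: leeD; apply: B => // x; [exact: le_Re_normc|exact: le_Im_normc].
Qed.

(** Hoelder's inequality against the constant function 1. *)
Lemma L1_le_L2norm f : cmeasurable f ->
  (\int[mu]_x (normc (f x))%:E <= L2norm mu f * mu setT `^ 2^-1)%E.
Proof.
move=> mf; have mN := measurable_normc mf.
have := @hoelder _ T R mu (fun x => normc (f x)) (cst 1) 2 2 mN.
move=> /(_ (measurable_cst _) (ltr0Sn _ _) (ltr0Sn _ _)).
have -> : 2^-1 + 2^-1 = 1 :> R by lra.
move=> /(_ erefl); rewrite Lnorm1 (Lnorm_cst1 mu 2).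
apply: le_trans; rewrite le_eqVlt; apply/orP; left; apply/eqP.
apply: eq_integral => x _.
by rewrite /= mulr1 ger0_norm// normc_ge0.
Qed.

End NormInequalities.

(** A single Fourier coefficient controls the space-time norm from below: its
    modulus [A] is at most twice the integral of [|u(t, z)|] over [z], for almost
    every [t]; integrating over [t] gives [pi * A <= ||u||_1], and the total mass
    is finite. Taking the modulus constant in [t] replaces any Fourier analysis
    in the time variable. The summand 1 only makes the constant positive. *)
Lemma spacetime_norm_ge (R : realType) (k : nat) (c : R -> fdist R k)
    (n n' : k.-tuple Z3) (A : R) :
  (forall t, normc (c t n n') = A) ->
  ((pi * A)%:E <=
   (1 + Num.sqrt (fine (spacetime_measure R k setT)))%:E * spacetime_norm c)%E.
Proof.
move=> cA; set V := fine _.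
have W0 : 0 < 1 + Num.sqrt V :> R by rewrite ltr_pwDl// sqrtr_ge0.
rewrite muleC -lee_pdivrMr//; apply: le_ereal_inf_tmp => _ [u [mu uc] <-].
rewrite lee_pdivrMr//.
have A0 : 0 <= A by rewrite -(cA 0) normc_ge0.
have mN := measurable_normc mu.
have V0 : 0 <= V by rewrite fine_ge0.
have VE : (spacetime_measure R k setT `^ 2^-1 = (Num.sqrt V)%:E)%E.
  rewrite -(@fineK _ (spacetime_measure R k setT)) ?fin_num_measure//.
  by rewrite poweR_EFin powR12_sqrt.
apply: (@le_trans _ _ (\int[spacetime_measure R k]_x (normc (u x))%:E)%E); last first.
  apply: (le_trans (L1_le_L2norm _ mu)).
  rewrite VE; apply: lee_wpmul2l; first exact: Lnorm_ge0.
  by rewrite lee_fin lerDr.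
pose F t := (\int[kernel_measure R k]_z (normc (u (t, z)))%:E)%E.
have mF : measurable_fun setT F.
  apply: (@measurable_fun_fubini_tonelli_F _ _ _ _ R (kernel_measure R k)
    (fun x => (normc (u x))%:E)).
    exact/measurable_EFinP.
  by move=> x; rewrite lee_fin normc_ge0.
have F0 t : (0 <= F t)%E.
  by apply: integral_ge0 => z _; rewrite lee_fin normc_ge0.
have -> : (\int[spacetime_measure R k]_x (normc (u x))%:E = \int[@circle_measure R]_t F t)%E.
  rewrite [LHS](@fubini_tonelli1 _ _ _ _ R (@circle_measure R) (kernel_measure R k)
    (fun x => (normc (u x))%:E))//.
    exact/measurable_EFinP.
  by move=> x; rewrite lee_fin normc_ge0.
have : (\int[@circle_measure R]_t (A / 2)%:E <= \int[@circle_measure R]_t F t)%E.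
  apply: ae_ge0_le_integral => //.
    by move=> t _; rewrite lee_fin divr_ge0.
  apply: filterS uc => t /(congr1 (fun f => f n n')) uct _.
  rewrite EFinM lee_pdivrMr// -(cA t) -uct fourierE muleC.
  have [m1 m2] := mu.
  have mut : cmeasurable (fun z => u (t, z)).
    by split; [exact: (measurableT_comp m1 (measurable_pair1 t))|
               exact: (measurableT_comp m2 (measurable_pair1 t))].
  have [mw _] := tame_conjc (tame_wave R (n, n')).
  apply: (le_trans (normc_cintegral_le _ (cmeasurableM mut mw))).
  rewrite le_eqVlt; apply/orP; left; apply/eqP; congr (_ * _)%E.
  apply: eq_integral => z _; congr (_%:E).
  rewrite ComplexField.Normc.normcM.
  have -> : conjc (wave (n, n') z) =
      expi (- (confphase z.1 (tnth n) - confphase z.2 (tnth n'))).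
    by rewrite expiN.
  by rewrite normc_expi mulr1.
apply: le_trans; rewrite integral_cst// [X in (_ * X)%E]circle_measureT -EFinM lee_fin.
by rewrite le_eqVlt; apply/orP; left; apply/eqP; field.
Qed.

(** * A resonant family of frequencies *)

Section Orbit.
Variable k : nat.
Notation freq := (k.-tuple Z3 * k.-tuple Z3)%type.
Implicit Types (q : freq) (l : seq freq).

(** The orbits of the frequencies in [l] under simultaneous permutations of the
    particles and exchange of the primed and unprimed variables. Duplicates are
    removed because [trig] sums over the list. *)
Definition sym_closure l : seq freq := undup
  ([seq perm_freq t q | q <- l, t <- enum 'S_k] ++
   [seq swap_freq (perm_freq t q) | q <- l, t <- enum 'S_k]).

Lemma sym_closureP l q : reflect
  (exists q0 (t : 'S_k), q0 \in l /\
     (q = perm_freq t q0 \/ q = swap_freq (perm_freq t q0)))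
  (q \in sym_closure l).
Proof.
rewrite mem_undup mem_cat; apply: (iffP orP).
  by case=> /allpairsP[[q0 t] /= [ql _ ->]]; exists q0, t; split => //; [left|right].
by move=> [q0 [t [ql [->|->]]]]; [left|right]; apply: allpairs_f => //; rewrite mem_enum.
Qed.

Lemma perm_freqM (t u : 'S_k) q : perm_freq t (perm_freq u q) = perm_freq (t * u)%g q.
Proof.
by rewrite /perm_freq /=; congr (_, _); apply/eq_from_tnth => i; rewrite !tnth_mktuple permM.
Qed.

Lemma perm_freq1 q : perm_freq 1%g q = q.
Proof.
case: q => n n'; rewrite /perm_freq /=; congr (_, _);
  by apply/eq_from_tnth => i; rewrite !tnth_mktuple perm1.
Qed.

Lemma sub_sym_closure l : {subset l <= sym_closure l}.
Proof.
move=> q ql; apply/sym_closureP; exists q, 1%g.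
by rewrite perm_freq1; split => //; left.
Qed.

Lemma swap_sym_closure l q : q \in sym_closure l -> swap_freq q \in sym_closure l.
Proof.
move=> /sym_closureP[q0 [t [ql [->|->]]]]; apply/sym_closureP; exists q0, t.
  by split => //; right.
by split => //; left.
Qed.

Lemma perm_sym_closure l q (t : 'S_k) :
  q \in sym_closure l -> perm_freq t q \in sym_closure l.
Proof.
move=> /sym_closureP[q0 [u [ql qE]]]; apply/sym_closureP; exists q0, (t * u)%g.
by split => //; case: qE => ->; rewrite -perm_freqM; [left|right].
Qed.

Lemma sum_undup_le (R : realType) (I : eqType) (s : seq I) (h : I -> R) :
  (forall i, 0 <= h i) -> \sum_(i <- undup s) h i <= \sum_(i <- s) h i.
Proof.
move=> h0; elim: s => [|i s IH] //=; rewrite [leRHS]big_cons.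
by case: ifP => _; rewrite ?big_cons ?lerD2l// (le_trans IH)// lerDr.
Qed.

Lemma sum_sym_closure_le (R : realType) l (h : freq -> R) : (forall q, 0 <= h q) ->
  (forall q, h (swap_freq q) = h q) -> (forall (t : 'S_k) q, h (perm_freq t q) = h q) ->
  \sum_(q <- sym_closure l) h q <= (2 * k`!)%:R * \sum_(q <- l) h q.
Proof.
move=> h0 hs hp; apply: (le_trans (sum_undup_le _ h0)).
rewrite big_cat !big_allpairs_dep /=.
under eq_bigr do under eq_bigr do rewrite hp.
under [X in _ + X]eq_bigr do under eq_bigr do rewrite hs hp.
rewrite -mulr2n mulr_sumr -sumrMnl; apply: ler_sum => q _.
rewrite big_const_seq count_predT -cardE card_Sn iter_addr_0.
by rewrite -mulrnA mulr_natl mulnC.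
Qed.

End Orbit.

Section Invariance.
Variables (R : realType) (k : nat).
Notation freq := (k.-tuple Z3 * k.-tuple Z3)%type.
Implicit Types (q : freq).

Lemma weight_swap q : weight R (swap_freq q) = weight R q.
Proof. by apply: eq_bigr => j _; rewrite mulrC. Qed.

Lemma weight_perm (t : 'S_k) q : weight R (perm_freq t q) = weight R q.
Proof.
rewrite /weight [RHS](reindex_inj (@perm_inj _ t)).
by apply: eq_bigr => i _; rewrite !tnth_mktuple.
Qed.

(** A component of the total momentum. Summing over primed and unprimed variables
    alike makes it invariant under both symmetries. *)
Definition momentum (a : 'I_3) q : int := \sum_(j < k) (tnth q.1 j + tnth q.2 j) 0 a.

Lemma momentum_swap a q : momentum a (swap_freq q) = momentum a q.
Proof. by apply: eq_bigr => j _; rewrite addrC. Qed.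

Lemma momentum_perm a (t : 'S_k) q : momentum a (perm_freq t q) = momentum a q.
Proof.
rewrite /momentum [RHS](reindex_inj (@perm_inj _ t)).
by apply: eq_bigr => i _; rewrite !tnth_mktuple.
Qed.

End Invariance.

Section Example.
Variable R : realType.

Definition vec3 (x y z : int) : Z3 := \row_(i < 3) [:: x; y; z]`_i.

Lemma vec3_coords x y z :
  [/\ vec3 x y z 0 0 = x, vec3 x y z 0 1 = y & vec3 x y z 0 (inord 2) = z].
Proof. by rewrite !mxE /= inordK. Qed.

Lemma sqnorm_vec3 x y z :
  sqnorm R (vec3 x y z) = x%:~R ^+ 2 + y%:~R ^+ 2 + z%:~R ^+ 2.
Proof. by rewrite /sqnorm !big_ord_recl big_ord0 !mxE /= addr0 addrA. Qed.

Lemma sqnorm0 : sqnorm R 0 = 0.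
Proof. by rewrite /sqnorm big1// => i _; rewrite mxE mulr0z expr0n. Qed.

Lemma perm_freq2 (t : 'S_2) (a b a' b' : Z3) :
  perm_freq t ([tuple a; b], [tuple a'; b']) = ([tuple a; b], [tuple a'; b']) \/
  perm_freq t ([tuple a; b], [tuple a'; b']) = ([tuple b; a], [tuple b'; a']).
Proof.
have two (i : 'I_2) : i = 0 \/ i = 1.
  by case: i => [[|[|//]] ?]; [left|right]; apply: val_inj.
have t01 : t 0 <> t 1 by move/perm_inj.
have E (x y : Z3) : tnth [tuple x; y] 0 = x /\ tnth [tuple x; y] 1 = y by [].
have [t0|t0] := two (t 0); have [t1|t1] := two (t 1);
  try (by case: t01; rewrite t0 t1); [left|right];
  rewrite /perm_freq /=; congr (_, _); apply/eq_from_tnth => i; rewrite tnth_mktuple;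
  by have [->|->] := two i; rewrite ?t0 ?t1.
Qed.

Variable N : nat.

(** The resonant family. With [u = (N, a, b)] and [r = (0, a, b)], the frequency is
    [(u, 0; 0, r)], and [|u|^2 + 0 - 0 - |r|^2 = N^2] does not depend on [(a, b)]. *)
Definition base (p : nat * nat) : 2.-tuple Z3 * 2.-tuple Z3 :=
  ([tuple vec3 N%:Z p.1%:Z p.2%:Z; 0], [tuple 0; vec3 0 p.1%:Z p.2%:Z]).

Lemma sym_closure_baseP (L : seq (nat * nat)) q : q \in sym_closure (map base L) ->
  exists2 p, p \in L &
    let u := vec3 N%:Z p.1%:Z p.2%:Z in let r := vec3 0 p.1%:Z p.2%:Z in
    [\/ q = ([tuple u; 0], [tuple 0; r]), q = ([tuple 0; u], [tuple r; 0]),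
        q = ([tuple 0; r], [tuple u; 0]) | q = ([tuple r; 0], [tuple 0; u])].
Proof.
move=> /sym_closureP[q0 [t [/mapP[p pL ->] qE]]]; exists p => //=.
have [E|E] := perm_freq2 t (vec3 N%:Z p.1%:Z p.2%:Z) 0 0 (vec3 0 p.1%:Z p.2%:Z).
  by case: qE => ->; rewrite /base E; [constructor 1|constructor 3].
by case: qE => ->; rewrite /base E; [constructor 2|constructor 4].
Qed.

Lemma momentum_base p : momentum 1 (base p) = (p.1 + p.1)%:Z.
Proof.
by rewrite /momentum !big_ord_recl big_ord0 /= !(tnth0, tnthS) !mxE /= !(addr0, add0r) PoszD.
Qed.

Lemma weight_base p : weight R (base p) ^+ 2 =
  (1 + (N%:R ^+ 2 + p.1%:R ^+ 2 + p.2%:R ^+ 2)) * (1 + (p.1%:R ^+ 2 + p.2%:R ^+ 2)).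
Proof.
rewrite /weight !big_ord_recl big_ord0 /= !(tnth0, tnthS) !sqnorm_vec3 sqnorm0.
rewrite -!pmulrn addr0 sqrtr1 !mulr1 expr0n add0r mul1r exprMn.
by rewrite !sqr_sqrtr// ?addr_ge0// sqr_ge0.
Qed.

(** Defining the coefficients through a symmetric quantity makes them symmetric.
    At the frequency [(u, 0; 0, r)] above, the momentum is [2 a], and the
    coefficient is [1 / (4 a^2)]. *)
Definition coef k (q : k.-tuple Z3 * k.-tuple Z3) : R := (momentum 1 q)%:~R ^- 2.

Lemma coef_base p : coef (base p) = 4^-1 * p.1%:R ^- 2.
Proof.
rewrite /coef momentum_base -pmulrn natrD -mulr2n -[_ *+ 2]mulr_natl exprMn invfM.
by congr (_^-1 * _); ring.
Qed.

Hypothesis N0 : (0 < N)%N.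
Variable L : seq (nat * nat).
Hypothesis uL : uniq L.
Hypothesis L0 : forall p, p \in L -> (0 < p.1)%N.

Let S := sym_closure (map base L).

Lemma vec3D x y z x' y' z' :
  vec3 x y z + vec3 x' y' z' = vec3 (x + x') (y + y') (z + z').
Proof. by apply/rowP => i; rewrite !mxE; case: i => [[|[|[|//]]] ?]. Qed.

Lemma vec3_inj x y z x' y' z' :
  vec3 x y z = vec3 x' y' z' -> [/\ x = x', y = y' & z = z'].
Proof.
have [X Y Z] := vec3_coords x y z; have [X' Y' Z'] := vec3_coords x' y' z'.
by move=> E; move: X Y Z; rewrite E X' Y' Z' => -> -> ->.
Qed.

Lemma vec30 : 0 = vec3 0 0 0 :> Z3.
Proof. by apply/rowP => i; rewrite !mxE; case: i => [[|[|[|//]]] ?]. Qed.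

(** Of the four frequencies in an orbit, only [(u, 0; 0, r)] contributes to the
    coefficient of the trace at [((N, 0, 0); 0)]; the others would force [a = 0]
    or [N = 0]. *)
Lemma Bplus_support (p : Z3 * Z3) :
  ([tuple vec3 N%:Z 0 0 - p.1 + p.2; p.1], [tuple 0; p.2]) \in S ->
  exists2 l, l \in L & p = (0, vec3 0 l.1%:Z l.2%:Z).
Proof.
move=> /sym_closure_baseP[[a b] lL H]; exists (a, b) => //; have /= l0 := L0 lL.
case: p H => p1 p2 /= H; case: H => -[].
- by move=> _ -> ->.
- move=> _ _ /esym; rewrite [RHS]vec30 => /vec3_inj[_ E _]; lia.
- move=> _ _ /esym; rewrite [RHS]vec30 => /vec3_inj[E _ _]; lia.
- move=> + E1 E2; rewrite E1 E2 subr0 vec3D => /vec3_inj[E _ _]; lia.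
Qed.

(** The frequency [(N, 0, 0)] never occurs in first position: the entries are 0,
    and [u] and [r], whose second component is [a > 0]. Hence the second half of the
    collision operator cannot cancel the first one. *)
Lemma Bminus_support (p : Z3 * Z3) (v : Z3) :
  ([tuple vec3 N%:Z 0 0; p.1], [tuple v; p.2]) \notin S.
Proof.
apply/negP => /sym_closure_baseP[[a b] lL H]; have /= l0 := L0 lL.
case: p H => p1 p2 /= H; case: H => -[].
- by move=> /vec3_inj[_ E _]; lia.
- by rewrite [RHS]vec30 => /vec3_inj[E _ _]; lia.
- by rewrite [RHS]vec30 => /vec3_inj[E _ _]; lia.
- by move=> /vec3_inj[E _ _]; lia.
Qed.

Lemma shift_freq1 (j : 'I_1) (d n : Z3) : shift_freq j d [tuple n] = [tuple n + d].
Proof. by apply/eq_from_tnth => i; rewrite tnth_mktuple !ord1 eqxx !tnth0. Qed.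

Lemma rcons1 (a b : Z3) : [tuple of rcons [tuple a] b] = [tuple a; b].
Proof. exact: val_inj. Qed.

(** By resonance, all the terms that contribute at the frequency [((N, 0, 0); 0)]
    carry the same phase, and the coefficients are positive: they add up without
    cancellation, at every time. *)
Lemma Bop_coefficient (j : 'I_1) (t : R) :
  Bop j (Uop t (fourier (trig S (@coef 2)))) [tuple vec3 N%:Z 0 0] [tuple 0] =
  expi (- (t * N%:R ^+ 2)) *
  ((2 * pi) ^+ 6 * (4^-1 * \sum_(l <- L) l.1%:R ^- 2))%:C.
Proof.
have uS : uniq S by exact: undup_uniq.
rewrite /Bop; have -> : Bminus j (Uop t (fourier (trig S (@coef 2))))
    [tuple vec3 N%:Z 0 0] [tuple 0] = 0.
  rewrite /Bminus (@csum_seq _ _ [::])//; first by rewrite big_nil mulr0.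
  move=> p _; rewrite /Uop fourier_trig// shift_freq1 !rcons1.
  by rewrite (negbTE (Bminus_support _ _)) mulr0 mulr0.
rewrite subr0 /Bplus.
pose s := [seq ((0 : Z3), vec3 0 l.1%:Z l.2%:Z) | l <- L].
rewrite (@csum_seq _ _ s); last 2 first.
- rewrite map_inj_uniq// => -[a b] [a' b'] [] /vec3_inj[_ [->] [->]] //.
- move=> p ps; rewrite /Uop fourier_trig// shift_freq1 !rcons1 addrA.
  case: ifP => [/Bplus_support[l lL pE]|_]; last by rewrite !mulr0.
  by move: ps; rewrite pE; rewrite map_f.
rewrite big_map big_seq.
have E l : l \in L -> Uop t (fourier (trig S (@coef 2)))
    [tuple of rcons (shift_freq j (- 0 + vec3 0 l.1%:Z l.2%:Z) [tuple vec3 N%:Z 0 0]) 0]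
    [tuple of rcons [tuple 0] (vec3 0 l.1%:Z l.2%:Z)] =
    expi (- (t * N%:R ^+ 2)) * ((2 * pi) ^+ (6 * 2) * (4^-1 * l.1%:R ^- 2))%:C.
  move=> lL; rewrite /Uop fourier_trig// shift_freq1 !rcons1 oppr0 add0r vec3D.
  rewrite addr0 !add0r -/(base l) sub_sym_closure ?map_f// coef_base.
  congr (expi (- (_ * _)) * _).
  rewrite !big_ord_recl !big_ord0 /= !(tnth0, tnthS) !sqnorm_vec3 sqnorm0 -!pmulrn.
  by rewrite expr0n /=; ring.
rewrite (eq_bigr _ (fun l => E l)) -big_seq /= -mulr_sumr mulrCA; congr (_ * _).
rewrite -rmorph_sum -rmorphM /=; congr (_%:C).
rewrite -!mulr_sumr.
have p0 : 2 * pi != 0 :> R by rewrite mulf_neq0// gt_eqF// pi_gt0.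
rewrite -[(6 * 2)%N]/(6 + 6)%N exprD.
by move: ((2 * pi) ^+ 6) (expf_neq0 6 p0) => y y0; field.
Qed.

(** On the base frequency the squared weight is [(1 + |u|^2) (1 + |r|^2)], where
    [b <= a] and [2 a <= N] give [1 + |r|^2 <= 3 a^2] and
    [1 + |u|^2 <= 2 (1 + N^2)]. One factor [1 / a^2] of the squared coefficient
    therefore survives; the remaining constants come from the four elements of an
    orbit and from [coef_base]. *)
Lemma sum_weight_coef_le : (forall p, p \in L -> (p.2 <= p.1)%N && (p.1 + p.1 <= N)%N) ->
  \sum_(q <- S) (weight R q * coef q) ^+ 2 <=
  (3 / 2) * (1 + N%:R ^+ 2) * \sum_(l <- L) l.1%:R ^- 2.
Proof.
move=> L1.
apply: (le_trans (@sum_sym_closure_le _ _ _ (fun q => (weight R q * coef q) ^+ 2) _ _ _)).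
- by move=> q; exact: sqr_ge0.
- by move=> q; rewrite weight_swap /coef momentum_swap.
- by move=> t q; rewrite weight_perm /coef momentum_perm.
rewrite big_map !mulr_sumr big_seq [leRHS]big_seq; apply: ler_sum => -[a b] lL.
have /= a0 := L0 lL; have /= /andP[ba aN] := L1 _ lL.
rewrite exprMn weight_base coef_base /=.
have A1 : 1 <= a%:R :> R by rewrite ler1n.
have A2 : b%:R <= a%:R :> R by rewrite ler_nat.
have A3 : a%:R + a%:R <= N%:R :> R by rewrite -natrD ler_nat.
have A4 : 0 <= b%:R :> R by [].
move: A1 A2 A3 A4; set x := a%:R; set y := b%:R; set z := N%:R => A1 A2 A3 A4.
have X1 : 1 <= x ^+ 2 by rewrite expr_ge1// (le_trans ler01).
have X2 : y ^+ 2 <= x ^+ 2 by rewrite lerXn2r// nnegrE (le_trans A4).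
have X3 : 4 * x ^+ 2 <= z ^+ 2.
  have -> : 4 * x ^+ 2 = (x + x) ^+ 2 by ring.
  by rewrite lerXn2r// nnegrE; lra.
have -> : (4^-1 * x ^- 2) ^+ 2 = (4 ^+ 2)^-1 * (x ^- 2 * x ^- 2).
  by rewrite exprMn exprVn [(x ^- 2) ^+ 2]expr2.
have i0 : 0 < x ^- 2 by rewrite invr_gt0; lra.
have i1 : x ^+ 2 * x ^- 2 = 1 by rewrite mulfV//; lra.
move: X1 X2 X3 i0 i1; set u := x ^+ 2; set v := y ^+ 2; set w := z ^+ 2; set i := u^-1.
have v0 : 0 <= v by exact: sqr_ge0.
move=> X1 X2 X3 i0 i1.
have P : (1 + (w + u + v)) * (1 + (u + v)) <= 2 * (1 + w) * (3 * u).
  by apply: ler_pM; lra.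
have -> : 3 / 2 * (1 + w) * i = 2 * 2 * (2 * (1 + w) * (3 * u)) * ((4 ^+ 2)^-1 * (i * i)).
  transitivity (3 / 2 * (1 + w) * i * (u * i)); first by rewrite i1 mulr1.
  by field.
have -> : (2 * 2`!)%:R = 2 * 2 :> R by rewrite -natrM.
rewrite [leLHS]mulrA; apply: ler_wpM2r; last by rewrite ler_pM2l//; lra.
by rewrite mulr_ge0 ?invr_ge0 ?exprn_ge0 ?mulr_ge0 ?ltW.
Qed.

End Example.

(** * The logarithmic divergence *)

Section Counterexample.
Variable R : realType.

Lemma harmonic_unbounded (K : R) : exists n, K < series (@harmonic R) n.
Proof.
apply: contrapT => /forallNP H; apply: (@dvg_harmonic R).
apply: nondecreasing_is_cvgn.
  by apply: nondecreasing_series => i _ _; exact: harmonic_ge0.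
by exists K => _ [n _ <-]; rewrite leNgt; apply/negP; exact: H.
Qed.

(** Restricting to [b <= a] keeps [|r|] comparable to [a], and each [a] occurs [a]
    times, which turns the sum of [1 / a^2] into a harmonic sum. *)
Definition triangle (M : nat) : seq (nat * nat) :=
  [seq (a, b) | a <- iota 1 M, b <- iota 1 a].

Lemma triangleP M p : p \in triangle M -> [/\ (0 < p.1)%N, (p.2 <= p.1)%N & (p.1 <= M)%N].
Proof.
move=> /allpairsPdep[a [b [aM bM ->]]] /=; move: aM bM; rewrite !mem_iota => ? ?; split; lia.
Qed.

Lemma uniq_triangle M : uniq (triangle M).
Proof.
apply: allpairs_uniq_dep => [|a _|]; try exact: iota_uniq.
by move=> [a b] [a' b'] _ _ /= [-> ->].
Qed.

Lemma sum_triangle M :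
  \sum_(p <- triangle M) p.1%:R ^- 2 = series (@harmonic R) M.
Proof.
rewrite /triangle big_allpairs_dep /= /series /=.
rewrite -[iota 1 M](map_id _) -[1%N]/(1 + 0)%N iotaDl big_map /= big_map /index_iota subn0.
apply: eq_bigr => i _; rewrite add1n.
rewrite big_const_seq count_predT size_iota iter_addr_0 -[LHS]mulr_natl.
by rewrite expr2 invfM mulrA mulfV ?mul1r// pnatr_eq0.
Qed.

(** Only the two-particle matrix matters. The components at the other levels are
    zero, written as empty polynomials so that one lemma covers every level. The
    first component [2 M] of the momentum dominates the frequencies in the
    triangle. *)
Definition counterexample (M : nat) (k : nat) : bikernel R k :=
  match k with
  | 2 => trig (sym_closure (map (base (2 * M)) (triangle M))) (@coef R 2)
  | k' => trig [::] (@coef R k')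
  end.

Arguments counterexample : clear implicits.

Lemma counterexample_H1 M : in_H1 (counterexample M).
Proof.
have H k l : density_matrix (trig (sym_closure l) (@coef R k)) /\
    (dist_norm (Sop (fourier (trig (sym_closure l) (@coef R k)))) < +oo)%E.
  have us : uniq (sym_closure l) by exact: undup_uniq.
  split; last by apply: (le_lt_trans (dist_norm_trig _ us)); rewrite ltry.
  apply: density_matrix_trig => // [q qs|t q qs].
    by rewrite swap_sym_closure// /coef momentum_swap.
  by rewrite perm_sym_closure// /coef momentum_perm.
have H0 k := H k [::].
by move=> [|[|[|k]]] //=.
Qed.

(** The left-hand side grows like [sqrt (1 + N^2) * H] and the right-hand side like
    [sqrt (1 + N^2) * sqrt H], with [H] the harmonic sum and [N = 2 M]; dividing
    by [sqrt (1 + N^2) * sqrt H] leaves a bound on [sqrt H]. *)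
Lemma counterexample_bounds M (j : 'I_1) (C : R) : (0 < M)%N -> 0 <= C ->
  (spacetime_norm (fun t : R => Sop (Bop j (Uop t (fourier (counterexample M 2)))))
     <= C%:E * dist_norm (Sop (fourier (counterexample M 2))))%E ->
  pi * (2 * pi) ^+ 6 / 4 * Num.sqrt (series (@harmonic R) M) <=
  (1 + Num.sqrt (fine (spacetime_measure R 1 setT))) *
  (C * Num.sqrt ((2 * pi) ^+ (6 * 2) * (3 / 2))).
Proof.
move=> M0 C0 hC; set H := series harmonic M.
have N0 : (0 < 2 * M)%N by rewrite muln_gt0.
have L0 p : p \in triangle M -> (0 < p.1)%N by move=> /triangleP[].
have L1 p : p \in triangle M -> (p.2 <= p.1)%N && (p.1 + p.1 <= 2 * M)%N.
  by move=> /triangleP[a b c]; rewrite b mul2n addnn leq_double.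
have pi0 : 0 < pi :> R by exact: pi_gt0.
have H0 : 0 < H.
  rewrite /H -(prednK M0) /series /= big_nat_recl//= invr1 ltr_pwDl//.
  by apply: sumr_ge0 => i _; rewrite invr_ge0.
set w := 1 + Num.sqrt _.
have w0 : 0 <= w by rewrite addr_ge0// sqrtr_ge0.
pose z : R := 1 + (2 * M)%:R ^+ 2.
have z0 : 0 < z by rewrite ltr_pwDl// sqr_ge0.
have B0 : 0 <= (2 * pi) ^+ 6 * (4^-1 * H) by rewrite !mulr_ge0 ?exprn_ge0 ?mulr_ge0 ?ltW// ltW.
have lower : ((pi * (Num.sqrt z * ((2 * pi) ^+ 6 * (4^-1 * H))))%:E <= w%:E *
    spacetime_norm (fun t : R => Sop (Bop j (Uop t (fourier (counterexample M 2))))))%E.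
  (* The coefficient is tested at the frequency ((N, 0, 0); 0). *)
  apply: (@spacetime_norm_ge R 1 _ [tuple vec3 (2 * M)%N%:Z 0 0] [tuple 0]) => t.
  rewrite /Sop Bop_coefficient ?uniq_triangle// sum_triangle -/H.
  rewrite !ComplexField.Normc.normcM normc_expi mul1r.
  rewrite !big_ord_recl !big_ord0 /= !tnth0 sqnorm_vec3 sqnorm0 -!pmulrn.
  rewrite !expr0n /= !addr0 sqrtr1 !mulr1 -/z !sqrtr_sqr.
  by rewrite [X in X * _]ger0_norm ?sqrtr_ge0// ger0_norm.
have upper : (dist_norm (Sop (fourier (counterexample M 2))) <=
    (Num.sqrt ((2 * pi) ^+ (6 * 2) * (3 / 2)) * (Num.sqrt z * Num.sqrt H))%:E)%E.
  apply: (le_trans (dist_norm_trig _ _)); first exact: undup_uniq.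
  have := @sum_weight_coef_le R _ _ L0 L1.
  rewrite sum_triangle -/H -/z => S.
  have K0 : 0 <= (2 * pi) ^+ (6 * 2) * (3 / 2) :> R.
    by rewrite mulr_ge0 ?exprn_ge0 ?mulr_ge0 ?divr_ge0 ?ltW.
  rewrite lee_fin -(sqrtrM _ (ltW z0)) -(sqrtrM _ K0) ler_wsqrtr//.
  by rewrite -[leRHS]mulrA ler_pM2l ?exprn_gt0 ?mulr_gt0// mulrA.
have : ((pi * (Num.sqrt z * ((2 * pi) ^+ 6 * (4^-1 * H))))%:E <=
    (w * (C * (Num.sqrt ((2 * pi) ^+ (6 * 2) * (3 / 2)) * (Num.sqrt z * Num.sqrt H))))%:E)%E.
  apply: (le_trans lower); rewrite EFinM; apply: lee_wpmul2l; first by rewrite lee_fin.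
  apply: (le_trans hC); rewrite EFinM; apply: lee_wpmul2l => //.
rewrite lee_fin -{1}[H](sqr_sqrtr (ltW H0)) => F.
have zH : 0 < Num.sqrt z * Num.sqrt H by rewrite mulr_gt0// sqrtr_gt0.
rewrite -(ler_pM2r zH); apply: le_trans (le_trans F _).
  by rewrite le_eqVlt; apply/orP; left; apply/eqP; ring.
by rewrite le_eqVlt; apply/orP; left; apply/eqP; ring.
Qed.

End Counterexample.

Theorem proposition3p3 (R : realType) :
  ~ exists C1 : R, 0 < C1 /\
    forall g : forall k, bikernel R k, in_H1 g ->
    forall (k : nat) (j : 'I_k),
      (spacetime_norm (fun t : R =>
         Sop (Bop j (Uop t (fourier (g k.+1)))))
       <= C1%:E * dist_norm (Sop (fourier (g k.+1))))%E.
Proof.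
move=> [C [C0 hC]].
pose a : R := pi * (2 * pi) ^+ 6 / 4.
pose b : R := (1 + Num.sqrt (fine (spacetime_measure R 1 setT))) *
  (C * Num.sqrt ((2 * pi) ^+ (6 * 2) * (3 / 2))).
have a0 : 0 < a by rewrite /a divr_gt0 ?mulr_gt0 ?exprn_gt0 ?mulr_gt0 ?pi_gt0.
have [M HM] := harmonic_unbounded (1 + (b / a) ^+ 2).
have M0 : (0 < M)%N.
  case: M HM => // ; rewrite /series /= big_geq// => /lt_geF.
  by rewrite addr_ge0// sqr_ge0.
have := @counterexample_bounds R M ord0 C M0 (ltW C0) (hC _ (@counterexample_H1 R M) 1%N ord0).
rewrite -/a -/b mulrC -ler_pdivlMr// => le_ba.
have : Num.sqrt (series (@harmonic R) M) ^+ 2 <= (b / a) ^+ 2.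
  rewrite lerXn2r// nnegrE ?sqrtr_ge0//.
  exact: le_trans (sqrtr_ge0 _) le_ba.
rewrite sqr_sqrtr; last first.
  by apply: ltW; apply: le_lt_trans HM; rewrite addr_ge0// sqr_ge0.
move=> /(lt_le_trans HM); rewrite gtrDr ltr10 //.
Qed.
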